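(* Let $\Bbbk$ be a field and let $A$ be a quantum graded algebra with a straightening law on a finite poset $(\Pi,\le_{\rm st})$ which has a single minimal element $\gamma$. Assume that $A$ is a domain, that for every upper neighbour $\tau$ of $\gamma$ in $\Pi$ the ideal $I_\tau=\langle\Pi^\tau\rangle$ is a completely prime ideal of $A$, and that $A[\gamma^{-1}]$ is a maximal order in its division ring of fractions. Then $A$ is a maximal order in its division ring of fractions.
   Context: Let $A$ be an $\mathbb{N}$-graded $\Bbbk$-algebra and $\Pi$ a finite subset of $A$ with a partial order $<_{\rm st}$. A standard monomial on $\Pi$ is either $1$ or a product $\alpha_1\cdots\alpha_s$ with $s\ge1$, $\alpha_i\in\Pi$ and $\alpha_1\le_{\rm st}\dots\le_{\rm st}\alpha_s$. $A$ is a quantum graded algebra with a straightening law (quantum graded A.S.L.) on $(\Pi,<_{\rm st})$ if: (1) the elements of $\Pi$ are homogeneous of positive degree; (2) $\Pi$ generates $A$ as a $\Bbbk$-algebra; (3) the set of standard monomials on $\Pi$ is linearly independent; (4) if $\alpha,\beta\in\Pi$ are not comparable, then $\alpha\beta$ is a linear combination of terms $\lambda$ or $\lambda\mu$ with $\lambda,\mu\in\Pi$, $\lambda\le_{\rm st}\mu$ and $\lambda<_{\rm st}\alpha,\beta$; (5) for all $\alpha,\beta\in\Pi$ there is $c_{\alpha\beta}\in\Bbbk^*$ such that $\alpha\beta-c_{\alpha\beta}\beta\alpha$ is a linear combination of terms $\lambda$ or $\lambda\mu$ with $\lambda,\mu\in\Pi$, $\lambda\le_{\rm st}\mu$ and $\lambda<_{\rm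 st}\alpha,\beta$. It is known that such an $A$ is noetherian, that the standard monomials form a $\Bbbk$-basis of $A$, and that when $\Pi$ has a single minimal element $\gamma$, $\gamma$ is a regular normal element of $A$ (normal: $\gamma A=A\gamma$). $A[\gamma^{-1}]$ denotes the localisation of $A$ at the powers of $\gamma$. For $\sigma\in\Pi$, $\Pi^\sigma=\{\pi\in\Pi\mid\pi\not\ge_{\rm st}\sigma\}$ and $I_\sigma=\langle\Pi^\sigma\rangle$ is the two-sided ideal of $A$ generated by $\Pi^\sigma$. An upper neighbour of $\sigma\in\Pi$ is an element $\tau\in\Pi$ with $\sigma<_{\rm st}\tau$ and no $\nu\in\Pi$ with $\sigma<_{\rm st}\nu<_{\rm st}\tau$. An ideal $I$ of $A$ is completely prime if $A/I$ is a domain. Maximal order: a noetherian domain $R$ with division ring of fractions $Q$ is a maximal order if there is no ring $B$ with $R\subsetneq B\subseteq Q$ and $aBb\subseteq R$ for some nonzero $a,b\in Q$. *)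

(* Defs.v *)
From HB Require Import structures.
From mathcomp Require Import all_boot all_order all_algebra.
From mathcomp Require Import boolp classical_sets.

Set Implicit Arguments.
Unset Strict Implicit.
Unset Printing Implicit Defensive.

Import Order.TTheory GRing.Theory.

Local Open Scope classical_set_scope.
Local Open Scope ring_scope.

Section Rings.
Variable R : nzRingType.
Implicit Types (I J : set R) (C : nat -> set R).

(* Possibly noncommutative; [1 != 0] holds in any [nzRingType]. *)
Definition is_domain := forall x y : R, x * y = 0 -> x = 0 \/ y = 0.

Definition left_ideal I :=
  zmod_closed [in I] /\ (forall r x, I x -> I (r * x)).

Definition right_ideal I :=
  zmod_closed [in I] /\ (forall x r, I x -> I (x * r)).

Definition two_sided_ideal I := left_ideal I /\ right_ideal I.

Definition ideal_generated (X : set R) : set R := smallest two_sided_ideal X.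

Definition ascending_chain_condition (P : set R -> Prop) :=
  forall C, (forall n, P (C n)) -> (forall n, C n `<=` C n.+1) ->
  exists N, forall n, (N <= n)%N -> C n = C N.

Definition noetherian :=
  ascending_chain_condition left_ideal /\
  ascending_chain_condition right_ideal.

(* "[R / I] is a domain", read off on representatives: [1 <> 0] and there are
   no zero divisors modulo [I]. *)
Definition completely_prime I :=
  [/\ two_sided_ideal I, ~ I 1 & forall x y, I (x * y) -> I x \/ I y].

(* [phi : R -> L] is the (right Ore) localisation of [R] at the powers of [g];
   this determines [phi] up to a unique isomorphism under [R]. *)
Definition is_localization_at_powers (g : R) (L : unitRingType)
    (phi : {rmorphism R -> L}) :=
  [/\ phi g \is a GRing.unit,
      forall l : L, exists (a : R) (n : nat), l = phi a / phi g ^+ n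
    & forall a : R, phi a = 0 -> exists n : nat, a * g ^+ n = 0].

Definition is_division_ring_of_fractions (Q : unitRingType)
    (iota : {rmorphism R -> Q}) :=
  [/\ forall q : Q, q != 0 -> q \is a GRing.unit,
      injective iota,
      forall q : Q, exists a b : R, b != 0 /\ q = iota a / iota b
    & forall q : Q, exists a b : R, b != 0 /\ q = (iota b)^-1 * iota a].

(* A noetherian domain has a division ring of fractions (Goldie, Ore), unique
   up to isomorphism, so quantifying over all of them is the same as fixing
   one. *)
Definition maximal_order :=
  [/\ noetherian, is_domain
    & forall (Q : unitRingType) (iota : {rmorphism R -> Q}),
        is_division_ring_of_fractions iota ->
        ~ exists B : set Q,
          [/\ subring_closed [in B], range iota `<` B
            & exists a b : Q, [/\ a != 0, b != 0
                & forall x, B x -> range iota (a * x * b)]]].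

End Rings.

Section GradedASL.
Variables (k : fieldType) (A : algType k).

Definition linear_combination_of (X : set A) (v : A) :=
  exists (n : nat) (c : 'I_n -> k) (x : 'I_n -> A),
    (forall i, X (x i)) /\ v = \sum_(i < n) c i *: x i.

(* [A] is the internal direct sum of the [gr n]. *)
Definition is_grading (gr : nat -> set A) :=
  [/\ forall n, submod_closed [in gr n],
      gr 0%N 1 /\ (forall m n x y, gr m x -> gr n y -> gr (m + n)%N (x * y)),
      forall a, exists (N : nat) (f : nat -> A),
        (forall i, gr i (f i)) /\ a = \sum_(i < N) f i
    & forall (N : nat) (f : nat -> A), (forall i, gr i (f i)) ->
        \sum_(i < N) f i = 0 -> forall i : nat, (i < N)%N -> f i = 0].

(* The finite partially ordered subset of [A] is given as a finite poset [Pi]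
   together with an injection [e : Pi -> A]. *)
Variables (d : Order.disp_t) (Pi : finPOrderType d) (e : Pi -> A).

Definition monomial (w : seq Pi) : A := \prod_(p <- w) e p.

(* Standard monomials are indexed by the weakly increasing words over [Pi],
   the empty word giving [1]; independence is that of this family. *)
Definition standard_word (w : seq Pi) : bool := sorted <=%O w.

Definition standard_monomials_independent :=
  forall (ws : seq (seq Pi)) (c : seq Pi -> k),
    uniq ws -> all standard_word ws ->
    \sum_(w <- ws) c w *: monomial w = 0 -> forall w, w \in ws -> c w = 0.

Definition straightening_term (alpha beta : Pi) : set A :=
  [set x | exists lambda : Pi, [/\ (lambda < alpha)%O, (lambda < beta)%O
     & x = e lambda \/
       exists2 mu : Pi, (lambda <= mu)%O & x = e lambda * e mu]].

Definition quantum_graded_ASL (gr : nat -> set A) :=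
  is_grading gr /\ injective e /\
  [/\ forall p, exists2 n : nat, (0 < n)%N & gr n (e p),
      smallest [set S : set A | subalg_closed [in S]] (range e) = setT,
      standard_monomials_independent,
      forall alpha beta : Pi, ~~ (alpha >=< beta)%O ->
        linear_combination_of (straightening_term alpha beta)
          (e alpha * e beta)
    & forall alpha beta : Pi, exists2 c : k, c != 0 &
        linear_combination_of (straightening_term alpha beta)
          (e alpha * e beta - c *: (e beta * e alpha))].

(* The two-sided ideal generated by the [p] in [Pi] with [~ (p >= sigma)]. *)
Definition ideal_not_above (sigma : Pi) : set A :=
  ideal_generated (e @` [set p | ~~ (sigma <= p)%O]).

End GradedASL.

Definition upper_neighbour (d : Order.disp_t) (T : porderType d)
    (sigma tau : T) :=
  (sigma < tau)%O /\ ~ exists nu : T, (sigma < nu)%O && (nu < tau)%O.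

Definition minimal (d : Order.disp_t) (T : porderType d) (x : T) :=
  forall y : T, ~~ (y < x)%O.

(* Main.v *)
(* By straightening, the standard monomials form a basis of [A], every
   completely prime ideal [I_tau] is spanned by the standard monomials whose
   first letter is not above [tau], and so the intersection of the [I_tau] over
   the upper neighbours [tau] of [gamma] is [gamma A]. A monomial order for which
   the generators commute up to a scalar and lower terms makes [A] noetherian by
   Dickson's lemma.

   Put [T = A[gamma^-1]] and let [B] be an overring of [A] in its fractions with
   [a B b] in [A]. One may take [a = 1] or [b = 1]. Maximality of [T] first
   forces [B] into [T]; noetherianity then gives a single [N] with
   [gamma^N B] in [A]. All powers of an element [q] of [B] thus have bounded
   denominator, which forces [q] into [A] because [gamma A] is an intersection
   of completely prime ideals stable under conjugation by [gamma]. *)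

From HB Require Import structures.
Require Import Defs.
From mathcomp Require Import all_boot all_order all_algebra.
From mathcomp Require Import boolp classical_sets.
From mathcomp Require Import zify.

Set Implicit Arguments.
Unset Strict Implicit.
Unset Printing Implicit Defensive.

Import Order.TTheory GRing.Theory.

Local Open Scope classical_set_scope.
Local Open Scope ring_scope.

(** * Dickson's lemma and the lexicographic order on lists of fixed length *)

Lemma minimal_value_after (f : nat -> nat) N :
  exists n, (N <= n)%N /\ forall m, (N <= m)%N -> (f n <= f m)%N.
Proof.
have [v ltv] : exists v, exists n, (N <= n)%N && (f n < v)%N.
  by exists (f N).+1, N; rewrite leqnn ltnSn.
have [n /andP[leNn ltn]] := ltv.
elim: v {ltv} n leNn ltn => // v IH n leNn ltn.
have [[m [leNm ltm]]|nex] := pselect (exists m, (N <= m)%N /\ (f m < f n)%N).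
  by apply: (IH m) => //; lia.
exists n; split=> // m leNm; rewrite leqNgt; apply/negP => ltm.
by apply: nex; exists m.
Qed.

(** The next index is always one, beyond the current one, at which [f] is minimal on the whole
    remaining tail. *)
Lemma nondecreasing_subsequence (f : nat -> nat) :
  exists g : nat -> nat, {homo g : i j / (i < j)%N} /\
                         {homo f \o g : i j / (i <= j)%N}.
Proof.
have [a aP] := choice (minimal_value_after f).
pose g := fix g n := if n is m.+1 then a (g m).+1 else a 0%N.
have [b [gS gm]] : exists b : nat -> nat, (forall n, (b n.+1 = (g n).+1)%N) /\
    forall n, g n = a (b n).
  by exists (fun n => if n is m.+1 then (g m).+1 else 0%N); split=> // -[|n].
have g_lt n : (g n < g n.+1)%N by rewrite (gm n.+1) gS; case: (aP (g n).+1).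
exists g; split; first exact: homo_ltn ltn_trans g_lt.
apply: (@homo_leq _ (fun i => f (g i)) leq) => [x|x y z|n].
- exact: leqnn.
- exact: leq_trans.
- rewrite (gm n); case: (aP (b n)) => leb; apply; rewrite -gm in leb.
  by rewrite (leq_trans leb) // ltnW.
Qed.

(** One coordinate at a time: a subsequence of a subsequence keeps the inequalities already
    gained. *)
Lemma dickson (I : Type) (s : seq I) (f : nat -> I -> nat) :
  exists g : nat -> nat, {homo g : i j / (i < j)%N} /\
    forall i j, (i <= j)%N -> all (fun p => f (g i) p <= f (g j) p)%N s.
Proof.
elim: s => [|p s [g [g_lt g_le]]]; first by exists id; split.
have [h [h_lt h_le]] := nondecreasing_subsequence (fun i => f (g i) p).
exists (g \o h); split=> [i j /h_lt /g_lt //|i j leij] /=.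
rewrite h_le //=; apply: g_le; move: leij; rewrite leq_eqVlt => /orP[/eqP->//|].
by move/h_lt/ltnW.
Qed.

Fixpoint lexlt (s t : seq nat) : bool :=
  match s, t with
  | a :: s', b :: t' => (a < b)%N || ((a == b) && lexlt s' t')
  | _, _ => false
  end.

Lemma lexlt_trans s t u : lexlt s t -> lexlt t u -> lexlt s u.
Proof.
elim: s t u => [|a s IH] [|b t] [|c u] //=.
move=> /orP[ab|/andP[/eqP-> st]] /orP[bc|/andP[/eqP bc tu]].
- by rewrite (ltn_trans ab bc).
- by rewrite -bc ab.
- by rewrite bc.
- by rewrite bc eqxx (IH _ _ st tu) orbT.
Qed.

Lemma lexlt_total s t : size s = size t -> [\/ s = t, lexlt s t | lexlt t s].
Proof.
elim: s t => [|a s IH] [|b t] //=; first by constructor 1.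
move=> [/IH H]; case: (ltngtP a b) => [ab|ab|<-]; [by constructor 2 | by constructor 3|].
by case: H => [->|st|st]; [constructor 1|constructor 2|constructor 3].
Qed.

(** Fixing the length makes the order well-founded: induction on the length, then on the first
    entry, then on the tail. *)
Lemma lexlt_wf_ind n (P : seq nat -> Prop) :
  (forall s, size s = n ->
     (forall t, size t = n -> lexlt t s -> P t) -> P s) ->
  forall s, size s = n -> P s.
Proof.
elim: n P => [|n IHn] P IP s; first by move/eqP; rewrite size_eq0 => /eqP->; apply: IP => // -[].
case: s => // a s [].
elim/ltn_ind: a s => a IHa s sn.
move: s sn; apply: (IHn (fun s => P (a :: s))) => s sn IHs.
apply: IP => /= [|[|b t] //= [tn]]; first by rewrite sn.
by case/orP=> [ltba|/andP[/eqP-> lts]]; [exact: IHa|exact: IHs].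
Qed.

Lemma zmod_closedB (V : zmodType) (I : set V) : GRing.zmod_closed [in I] ->
  I 0 /\ forall x y, I x -> I y -> I (x - y).
Proof.
case=> I0 IB; split=> [|x y Ix Iy]; first by move: I0; rewrite in_setE.
by move: (IB x y); rewrite !in_setE; apply.
Qed.

(** * Spans of words and straightening *)

Section Words.
Variables (k : fieldType) (A : algType k).
Variables (d : Order.disp_t) (Pi : finPOrderType d) (e : Pi -> A).
Implicit Types (w u v : seq Pi) (W : seq Pi -> Prop) (p q : Pi) (x y : A).

Notation mon := (monomial e).

Lemma monomial_cat u v : mon (u ++ v) = mon u * mon v.
Proof. by rewrite /monomial big_cat. Qed.

Lemma monomial_cons p v : mon (p :: v) = e p * mon v.
Proof. by rewrite /monomial big_cons. Qed.

Lemma monomial_nil : mon [::] = 1.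
Proof. by rewrite /monomial big_nil. Qed.

(** Spans are indexed by words rather than by elements, so that weights and letters can be followed
    even though distinct words may have equal monomials. *)
Inductive word_span W : A -> Prop :=
| word_span0 : word_span W 0
| word_spanD c w y : W w -> word_span W y -> word_span W (c *: mon w + y).

Lemma word_spanw W w : W w -> word_span W (mon w).
Proof.
by move=> Ww; rewrite -[mon w]scale1r -[_ *: _]addr0; constructor=> //; constructor.
Qed.

Lemma word_span_add W x y : word_span W x -> word_span W y -> word_span W (x + y).
Proof.
elim=> [|c w x' Ww _ IH] Sy; first by rewrite add0r.
by rewrite -addrA; constructor=> //; apply: IH.
Qed.

Lemma word_spanZ W c x : word_span W x -> word_span W (c *: x).
Proof.
elim=> [|c' w x' Ww _ IH]; first by rewrite scaler0; constructor.
by rewrite scalerDr scalerA; constructor.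
Qed.

Lemma word_spanB W x y : word_span W x -> word_span W y -> word_span W (x - y).
Proof. by move=> Sx Sy; rewrite -scaleN1r; apply: word_span_add => //; apply: word_spanZ. Qed.

Lemma word_span_trans W W' x : (forall w, W w -> word_span W' (mon w)) ->
  word_span W x -> word_span W' x.
Proof.
move=> WW'; elim=> [|c w y Ww _ IH]; first by constructor.
by apply: word_span_add => //; apply/word_spanZ/WW'.
Qed.

Lemma word_spanS W W' x : (forall w, W w -> W' w) ->
  word_span W x -> word_span W' x.
Proof. by move=> WW'; apply: word_span_trans => w Ww; apply/word_spanw/WW'. Qed.

Lemma word_spanMl W W' u x : (forall w, W w -> W' (u ++ w)) ->
  word_span W x -> word_span W' (mon u * x).
Proof.
move=> WW'; elim=> [|c w y Ww _ IH]; first by rewrite mulr0; constructor.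
by rewrite mulrDr -scalerAr -monomial_cat; constructor=> //; apply: WW'.
Qed.

Lemma word_spanMr W W' u x : (forall w, W w -> W' (w ++ u)) ->
  word_span W x -> word_span W' (x * mon u).
Proof.
move=> WW'; elim=> [|c w y Ww _ IH]; first by rewrite mul0r; constructor.
by rewrite mulrDl -scalerAl -monomial_cat; constructor=> //; apply: WW'.
Qed.

Lemma word_spanM W1 W2 W x y : (forall u v, W1 u -> W2 v -> W (u ++ v)) ->
  word_span W1 x -> word_span W2 y -> word_span W (x * y).
Proof.
move=> WW Sx Sy; elim: Sx => [|c w z Ww _ IH]; first by rewrite mul0r; constructor.
rewrite mulrDl; apply: word_span_add => //; rewrite -scalerAl; apply: word_spanZ.
by apply: word_spanMl Sy => v; apply: WW.
Qed.

Lemma linear_combination_word_span (X : set A) W y :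
  (forall x, X x -> word_span W x) -> linear_combination_of X y -> word_span W y.
Proof.
move=> XW [n [c [x [Xx ->]]]]; elim/big_rec: _ => [|i z _ Sz]; first by constructor.
by apply: word_span_add => //; apply/word_spanZ/XW.
Qed.

Lemma generated_word_span :
  smallest [set S : set A | GRing.subalg_closed [in S]] (range e) = setT ->
  forall x, word_span (fun=> True) x.
Proof.
move=> gen x; have : [set: A] x by [].
rewrite -gen; apply; split=> /=.
  split; rewrite ?in_setE.
  - by rewrite -monomial_nil; apply: word_spanw.
  - move=> c u v; rewrite !in_setE => Su Sv.
    by apply: word_span_add => //; apply: word_spanZ.
  - by move=> u v; rewrite !in_setE; apply: word_spanM.
move=> _ [p _ <-]; rewrite -[e p]mulr1 -monomial_nil -monomial_cons.
exact: word_spanw.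
Qed.

Hypothesis gen_e : forall x, word_span (fun=> True) x.

Definition rank p := #|[pred q : Pi | (q < p)%O]|.

Lemma rank_lt p q : (p < q)%O -> (rank p < rank q)%N.
Proof.
move=> ltpq; apply: proper_card; apply/properP; split.
  by apply/fintype.subsetP => r; rewrite !inE => /lt_trans; apply.
by exists p; rewrite !inE ?ltxx.
Qed.

(* The weights are convex enough that [weight [:: l; m]] drops below
   [weight [:: a; b]] as soon as [l < a, b], whatever [m] is. *)
Definition letter_weight p : nat := (2 * 3 ^ #|Pi| - 3 ^ (#|Pi| - rank p))%N.

Definition weight w : nat := \sum_(p <- w) letter_weight p.

Lemma rank_max p : (rank p < #|Pi|)%N.
Proof.
apply: proper_card; apply/properP; split; first exact/fintype.subsetP.
by exists p; rewrite !inE ?ltxx.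
Qed.

(** A smaller rank at least triples the power of 3 that is subtracted, so the powers for [a] and [b]
    together are at most two thirds of the one for [l]. *)
Lemma letter_weight_straight a b l : (l < a)%O -> (l < b)%O ->
  (letter_weight l < letter_weight a + letter_weight b)%N /\
  forall m, (letter_weight l + letter_weight m < letter_weight a + letter_weight b)%N.
Proof.
move=> /rank_lt la /rank_lt lb; have := rank_max a; have := rank_max b.
rewrite /letter_weight; set n := #|Pi|; move: (rank l) (rank a) (rank b) la lb.
move=> rl ra rb la lb rbn ran.
have pow_le i j : (i <= j)%N -> (3 ^ i <= 3 ^ j)%N by move=> ?; rewrite leq_pexp2l.
have la3 : (3 * 3 ^ (n - ra) <= 3 ^ (n - rl))%N by rewrite -expnS; apply: pow_le; lia.
have lb3 : (3 * 3 ^ (n - rb) <= 3 ^ (n - rl))%N by rewrite -expnS; apply: pow_le; lia.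
have := pow_le (n - rl)%N n; have := expn_gt0 3 (n - ra)%N; have := expn_gt0 3 (n - rb)%N.
move=> /= h1 h2 h3; split=> [|m]; first lia.
have := expn_gt0 3 (n - rank m)%N; have := pow_le (n - rank m)%N n; lia.
Qed.

Lemma weight_cat u v : weight (u ++ v) = (weight u + weight v)%N.
Proof. exact: big_cat. Qed.

Lemma weight_cons p v : weight (p :: v) = (letter_weight p + weight v)%N.
Proof. exact: big_cons. Qed.

Lemma weight_perm u v : perm_eq u v -> weight u = weight v.
Proof. exact: perm_big. Qed.

(** The invariant of straightening: a letter may vanish, but some letter below or equal to it
    survives. It later keeps track of letters that are not above [tau]. *)
Definition dominated w u := forall p, p \in w -> exists2 q, q \in u & (q <= p)%O.

Lemma dominated_refl w : dominated w w.
Proof. by move=> p pw; exists p. Qed.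

Lemma dominated_perm u v w : perm_eq u v -> dominated u w -> dominated v w.
Proof. by move=> /perm_mem uv D p; rewrite -uv; apply: D. Qed.

Lemma dominated_trans u v w : dominated u v -> dominated v w -> dominated u w.
Proof.
by move=> D1 D2 p /D1[q /D2[r rw le1] le2]; exists r => //; apply: le_trans le2.
Qed.

Lemma dominated_cons p u v : dominated u v -> dominated (p :: u) (p :: v).
Proof.
move=> D q; rewrite inE => /orP[/eqP->|/D[r rv le]].
  by exists p; rewrite ?mem_head.
by exists r; rewrite // inE rv orbT.
Qed.

Definition below w u := (weight u < weight w)%N /\ dominated w u.

Lemma below_perm u v x : perm_eq u v ->
  word_span (below u) x -> word_span (below v) x.
Proof.
move=> uv; apply: word_spanS => w [lt D].
by split; [rewrite -(weight_perm uv) | apply: dominated_perm D].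
Qed.

Lemma straightening_below a b s x :
  linear_combination_of (straightening_term e a b) x ->
  word_span (below [:: a, b & s]) (x * mon s).
Proof.
move=> lc; pose W u := below [:: a, b & s] (u ++ s).
suff: word_span W x by apply: word_spanMr.
apply: linear_combination_word_span lc => y [l [la lb Hy]].
have [w1 w2] := letter_weight_straight la lb.
have dom u : l \in u -> dominated [:: a, b & s] (u ++ s).
  move=> lu p; rewrite !inE => /or3P[/eqP->|/eqP->|ps].
  - by exists l; rewrite ?mem_cat ?lu // ltW.
  - by exists l; rewrite ?mem_cat ?lu // ltW.
  - by exists p; rewrite ?mem_cat ?ps ?orbT.
case: Hy => [->|[m _ ->]].
  rewrite -[e l]mulr1 -monomial_nil -monomial_cons; apply: word_spanw; split.
    by rewrite !weight_cons /=; lia.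
  by apply: dom; rewrite mem_head.
rewrite -[e m]mulr1 -monomial_nil -!monomial_cons; apply: word_spanw; split.
  by rewrite !weight_cons /= addnA addnA ltn_add2r.
by apply: dom; rewrite mem_head.
Qed.

Hypothesis incomparable : forall a b : Pi, ~~ (a >=< b)%O ->
  linear_combination_of (straightening_term e a b) (e a * e b).
Hypothesis quasi_commute : forall a b : Pi, exists2 c : k, c != 0 &
  linear_combination_of (straightening_term e a b) (e a * e b - c *: (e b * e a)).

Definition similar w w' := exists2 c : k, c != 0 & word_span (below w) (mon w - c *: mon w').

Lemma similar_refl w : similar w w.
Proof. by exists 1; rewrite ?oner_neq0 // scale1r subrr; constructor. Qed.

Lemma similar_trans u v w : perm_eq u v -> similar u v -> similar v w -> similar u w.
Proof.
move=> uv [c c0 Hc] [c' c'0 Hc']; exists (c * c'); first by rewrite mulf_neq0.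
have -> : mon u - (c * c') *: mon w =
    (mon u - c *: mon v) + c *: (mon v - c' *: mon w).
  by rewrite scalerBr scalerA subrKA.
apply: word_span_add => //; apply: word_spanZ.
by apply: below_perm Hc'; rewrite perm_sym.
Qed.

Lemma similar_cons p u v : similar u v -> similar (p :: u) (p :: v).
Proof.
case=> c c0 H; exists c => //.
rewrite !monomial_cons scalerAr -mulrBr -[e p]mulr1 -monomial_nil -monomial_cons.
apply: word_spanMl H => w [lt D] /=; split; first by rewrite !weight_cons ltn_add2l.
exact: dominated_cons.
Qed.

Lemma similar_swap a b s : similar [:: a, b & s] [:: b, a & s].
Proof.
have [c c0 H] := quasi_commute a b; exists c => //.
rewrite !monomial_cons !mulrA scalerAl -mulrBl.
exact: straightening_below.
Qed.

Lemma similar_move s1 p s2 : similar (s1 ++ p :: s2) (p :: s1 ++ s2).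
Proof.
elim: s1 => [|a s1 IH] /=; first exact: similar_refl.
apply: (similar_trans _ (similar_cons a IH) (similar_swap _ _ _)).
by rewrite perm_cons perm_catC /= perm_cons perm_catC.
Qed.

(** The letters of [w'] are brought to the front of [w] one after the other, each by adjacent
    swaps. *)
Lemma perm_similar w w' : perm_eq w w' -> similar w w'.
Proof.
elim: w' w => [|p t IH] w.
  by move/perm_size/eqP; rewrite size_eq0 => /eqP->; apply: similar_refl.
move=> pw; have : p \in w by rewrite (perm_mem pw) mem_head.
move=> /splitPr ws; case: ws pw => s1 s2 pw.
have pm : perm_eq (s1 ++ p :: s2) (p :: s1 ++ s2).
  by rewrite perm_catC /= perm_cons perm_catC.
apply: (similar_trans pm (similar_move _ _ _)); apply/similar_cons/IH.
by rewrite -(perm_cons p) -(permPl pm).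
Qed.

(** Induction on the weight. If the letters are pairwise comparable, sorting gives a standard word
    up to terms below; otherwise an incomparable pair is moved to the front and straightened, which
    leaves only terms below. *)
Lemma standard_span w :
  word_span (fun v => standard_word v /\ dominated w v) (mon w).
Proof.
have [n] := ubnP (weight w); elim: n w => // n IH w ltn.
have low u : weight u = weight w -> forall x, word_span (below u) x ->
    word_span (fun v => standard_word v /\ dominated u v) x.
  move=> wu x; apply: word_span_trans => v [ltv D].
  have ltvn : (weight v < n)%N by lia.
  by apply: word_spanS (IH v ltvn) => t [st D']; split=> //; apply: dominated_trans D'.
have [/allrelP cmp|] := boolP (allrel (fun a b => (a >=< b)%O) w w).
  have pw : perm_eq w (sort <=%O w) by rewrite perm_sym perm_sort.
  have [c c0 /(low _ erefl) H] := perm_similar pw.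
  rewrite -[mon w](subrK (c *: mon (sort <=%O w))); apply: word_span_add => //.
  apply/word_spanZ/word_spanw; split; last first.
    by apply: (dominated_perm _ (@dominated_refl _)); rewrite perm_sort.
  apply: (@sort_sorted_in _ (mem w)); last exact/allP.
  by move=> a b aw bw; apply: cmp.
rewrite /allrel => /allPn[a aw /allPn[b bw ncmp]].
(* As [a] is comparable with itself, [b] is another letter, hence still present in [rem a w]. *)
have nab : b != a by apply: contraNneq ncmp => ->; rewrite comparablexx.
have pw : perm_eq w [:: a, b & rem b (rem a w)].
  apply: (perm_trans (perm_to_rem aw)); rewrite perm_cons; apply: perm_to_rem.
  by apply: rem_mem.
have [c c0 /(low _ erefl) H] := perm_similar pw.
rewrite -[mon w](subrK (c *: mon [:: a, b & rem b (rem a w)])); apply: word_span_add => //.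
apply: word_spanZ; have := low _ (esym (weight_perm pw)).
move=> /(_ (mon [:: a, b & rem b (rem a w)])); rewrite perm_sym in pw.
move=> L; apply: word_spanS (L _) => [v [sv D]|].
  by split=> //; apply: dominated_perm D.
rewrite !monomial_cons mulrA; apply: straightening_below; exact: incomparable.
Qed.

(* Compared lexicographically, keys give an additive well-order on words up to
   permutation. Since [monomial] need not be injective on such classes,
   [leading_word] is a relation rather than a function. *)
Definition key w : seq nat := weight w :: [seq count_mem p w | p <- enum Pi].

Lemma size_key w : size (key w) = #|Pi|.+1.
Proof. by rewrite /= size_map -cardE. Qed.

Lemma key_perm u v : perm_eq u v -> key u = key v.
Proof.
move=> uv; rewrite /key (weight_perm uv); congr (_ :: _); apply: eq_map => p.
exact: permP.
Qed.

Lemma perm_key u v : key u = key v -> perm_eq u v.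
Proof.
case=> _ /eq_in_map H; apply/allP => p _ /=; apply/eqP/H.
by rewrite mem_enum.
Qed.

Lemma lexlt_key_cat s u v : lexlt (key u) (key v) -> lexlt (key (s ++ u)) (key (s ++ v)).
Proof.
rewrite /= !weight_cat ltn_add2l eqn_add2l => /orP[->//|/andP[-> H]] /=.
apply/orP; right; elim: (enum Pi) H => //= p l IH.
rewrite !count_cat ltn_add2l eqn_add2l => /orP[->//|/andP[-> /IH ->]].
by rewrite orbT.
Qed.

(** * Leading words and the ascending chain condition *)

Definition lower_span s := word_span (fun u => lexlt (key u) s).

Definition leading_word (I : set A) w :=
  exists2 y, I y & lower_span (key w) (y - mon w).

Definition subspace (I : set A) :=
  (forall x y, I x -> I y -> I (x - y)) /\ (forall (c : k) x, I x -> I (c *: x)).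

Lemma perm_lower w w' : perm_eq w w' ->
  exists2 c : k, c != 0 & lower_span (key w) (mon w - c *: mon w').
Proof.
case/perm_similar=> c c0 H; exists c => //; apply: word_spanS H => u [lt _].
by rewrite /= lt.
Qed.

Lemma leading_word_perm (I : set A) w w' : subspace I ->
  perm_eq w w' -> leading_word I w -> leading_word I w'.
Proof.
move=> [_ IZ] pw [y Iy Hy].
have [c c0 H] := perm_lower pw; exists (c^-1 *: y); first exact: IZ.
rewrite -(key_perm pw).
have -> : c^-1 *: y - mon w' = c^-1 *: ((y - mon w) + (mon w - c *: mon w')).
  by rewrite subrKA scalerBr scalerA mulVf // scale1r.
by apply/word_spanZ/word_span_add.
Qed.

(** This is divisibility of leading words: the inequalities make [w'] a rearrangement of [w] with
    extra letters, [closed] supplies these letters, and quasi-commutation absorbs the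
    rearrangement. *)
Lemma leading_word_count (I : set A) w w' : subspace I ->
  (forall u v, leading_word I v -> exists2 t, perm_eq t (u ++ v) & leading_word I t) ->
  (forall p, count_mem p w <= count_mem p w')%N ->
  leading_word I w -> leading_word I w'.
Proof.
move=> sI closed /count_subseqP[v /perm_to_subseq[s ps] pv] Lw.
have [t pt Lt] := closed s w Lw; apply: leading_word_perm Lt => //.
rewrite (permPl pt) (permPr ps) perm_catC.
by rewrite perm_cat2r.
Qed.

(** Words with the same key are permutations of each other, so their monomials are proportional
    modulo lower words and merge into one top term, which may cancel. *)
Lemma lower_span_top s x : word_span (fun u => key u = s \/ lexlt (key u) s) x ->
  lower_span s x \/
  exists w (c : k), [/\ c != 0, key w = s & lower_span s (x - c *: mon w)].
Proof.
elim=> [|c w y Hw _ IH]; first by left; constructor.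
have [->|c0] := eqVneq c 0; first by rewrite scale0r add0r.
case: Hw => [Hw|Hw]; last first.
  have Sw : lower_span s (c *: mon w) by apply/word_spanZ/word_spanw.
  case: IH => [L|[w' [c' [c'0 kw' L]]]]; first by left; apply: word_span_add.
  by right; exists w', c'; split=> //; rewrite -addrA; apply: word_span_add.
case: IH => [L|[w' [c' [c'0 kw' L]]]].
  by right; exists w, c; split=> //; rewrite addrC addKr.
have [b b0 Sb] : exists2 b : k, b != 0 & lower_span s (mon w' - b *: mon w).
  by rewrite -kw'; apply: perm_lower; apply: perm_key; rewrite Hw.
have S : lower_span s (c *: mon w + y - (c + c' * b) *: mon w).
  have -> : c *: mon w + y - (c + c' * b) *: mon w =
      (y - c' *: mon w') + c' *: (mon w' - b *: mon w).
    rewrite scalerDl scalerBr scalerA subrKA opprD addrA.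
    by rewrite [c *: _ + y]addrC addrK.
  by apply: word_span_add => //; apply: word_spanZ.
have [E|n0] := eqVneq (c + c' * b) 0.
  by left; move: S; rewrite E scale0r subr0.
by right; exists w, (c + c' * b).
Qed.

Lemma lower_span_max s x : lower_span s x ->
  x = 0 \/ exists u, lexlt (key u) s /\
    word_span (fun v => key v = key u \/ lexlt (key v) (key u)) x.
Proof.
elim=> [|c w y lw _ IH]; first by left.
right; case: IH => [->|[u [lu Su]]].
  exists w; split=> //; apply: word_span_add; last by constructor.
  by apply/word_spanZ/word_spanw; left.
have [E|lt|lt] := lexlt_total (etrans (size_key w) (esym (size_key u))).
- by exists u; split=> //; constructor=> //; left.
- by exists u; split=> //; constructor=> //; right.
- exists w; split=> //; constructor; first by left.
  by apply: word_spanS Su => v [->|lv]; right=> //; apply: lexlt_trans lt.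
Qed.

(** Reduction as for Groebner bases: an element of [J] loses its leading word by subtracting a
    multiple of an element of [I], and induction on the key handles the remainder. *)
Lemma leading_word_sub (I J : set A) : subspace I -> subspace J -> I 0 -> I `<=` J ->
  (forall w, leading_word J w -> leading_word I w) -> J `<=` I.
Proof.
move=> [IB IZ] [JB JZ] I0 IJ LT x.
have main s : size s = #|Pi|.+1 -> forall x,
    word_span (fun u => key u = s \/ lexlt (key u) s) x -> J x -> I x.
  move: s; apply: lexlt_wf_ind => s ns IH.
  have low z : lower_span s z -> J z -> I z.
    case/lower_span_max => [->//|[u [lu Su]]].
    by apply: IH lu _ Su; apply: size_key.
  move=> z /lower_span_top[/low//|[w [c [c0 kw S]]]] Jz.
  have [y Iy Sy] : leading_word I w.
    apply: LT; exists (c^-1 *: z); first exact: JZ.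
    have -> : c^-1 *: z - mon w = c^-1 *: (z - c *: mon w).
      by rewrite scalerBr scalerA mulVf // scale1r.
    by rewrite kw; apply: word_spanZ.
  have Icy : I (c *: y) by apply: IZ.
  have : I (z - c *: y).
    apply: low; last by apply: JB => //; apply: IJ.
    have -> : z - c *: y = (z - c *: mon w) - c *: (y - mon w).
      by rewrite scalerBr opprB addrA subrK.
    by apply: word_spanB => //; apply: word_spanZ; rewrite -kw.
  move=> H; have -> : z = (z - c *: y) - (0 - c *: y) by rewrite sub0r opprK subrK.
  by apply: (IB) => //; apply: IB.
have [s ns Ss] : exists2 s, size s = #|Pi|.+1 & lower_span s x.
  elim: (gen_e x) => [|c w y _ _ [s ns Ss]].
    by exists (nseq #|Pi|.+1 0%N); rewrite ?size_nseq //; constructor.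
  (* The first entry of the new bound exceeds both [weight w] and [a], so it bounds the new word and
     all the earlier ones. *)
  case: s ns Ss => // a s [ns] Ss; exists ((weight w).+1 + a :: s)%N; rewrite /= ?ns //.
  constructor; first by rewrite /= addSn ltnS leq_addr.
  apply: word_spanS Ss => u /= /orP[lt|/andP[/eqP-> _]]; apply/orP; left; lia.
by case: (lower_span_max Ss) => [->//|[u [lu Su]]]; apply: main Su; apply: size_key.
Qed.

(** A chain that never stabilises yields infinitely many stages, each with a new leading word; by
    Dickson's lemma an earlier one divides a later one, which is thus not new. The hypothesis on
    [u ++ v] up to permutation covers left and right ideals alike. *)
Lemma acc_of_leading_words (P : set A -> Prop) :
  (forall I, P I -> subspace I /\ I 0) ->
  (forall I u v, P I -> leading_word I v ->
     exists2 t, perm_eq t (u ++ v) & leading_word I t) ->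
  ascending_chain_condition P.
Proof.
move=> sub closed C PC incC.
have leC m n : (m <= n)%N -> C m `<=` C n.
  move=> /subnK <-; elim: (n - m)%N => // i IH; apply: subset_trans IH _.
  by rewrite addSn.
apply: contrapT => nstab.
have step N : exists nw : nat * seq Pi,
    [/\ (N <= nw.1)%N, leading_word (C nw.1) nw.2 & ~ leading_word (C N) nw.2].
  apply: contrapT => nex; apply: nstab; exists N => n leNn.
  apply/seteqP; split; last exact: leC.
  have [[sN CN0] [sn _]] := (sub _ (PC N), sub _ (PC n)).
  apply: leading_word_sub (leC _ _ leNn) _ => // w Lw.
  by apply: contrapT => nL; apply: nex; exists (n, w).
have [h hP] := choice step.
pose N := fix N i := if i is j.+1 then (h (N j)).1 else 0%N.
pose f i := (h (N i)).2.
have leN : {homo N : i j / (i <= j)%N}.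
  apply: (@homo_leq _ N leq) => [x|x y z|i]; [exact: leqnn|exact: leq_trans|].
  by rewrite /=; case: (hP (N i)).
have [g [g_lt g_le]] := dickson (enum Pi) (fun i p => count_mem p (f i)).
have lt01 := g_lt 0%N 1%N isT; have /allP le01 := g_le 0%N 1%N isT.
have [_ L0 _] := hP (N (g 0%N)); have [_ _ nL1] := hP (N (g 1%N)).
apply: nL1; apply: (@leading_word_count _ (f (g 0%N))).
- by case: (sub _ (PC (N (g 1%N)))).
- by move=> u v; apply: closed.
- by move=> p; apply: le01; rewrite mem_enum.
(* [f (g 0)] is found as a leading word at stage [N (g 0 + 1)], which is at most [N (g 1)] because
   [g 0 < g 1]. *)
- by case: L0 => y Cy Hy; exists y => //; apply: leC Cy; apply: (leN (g 0%N).+1).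
Qed.

Lemma noetherian_of_straightening : noetherian A.
Proof.
split; apply: acc_of_leading_words.
- move=> I [/zmod_closedB[I0 IB] IM]; do 2 split=> //.
  by move=> c x Ix; rewrite -[x]mul1r scalerAl; apply: IM.
- move=> I u v [_ IM] [y Iy Hy]; exists (u ++ v) => //.
  exists (mon u * y); first exact: IM.
  rewrite monomial_cat -mulrBr; apply: word_spanMl Hy => w.
  exact: lexlt_key_cat.
- move=> I [/zmod_closedB[I0 IB] IM]; do 2 split=> //.
  by move=> c x Ix; rewrite -[x]mulr1 scalerAr; apply: IM.
- move=> I u v [_ IM] [y Iy Hy]; exists (v ++ u); first by rewrite perm_catC.
  exists (y * mon u); first exact: IM.
  rewrite monomial_cat -mulrBl; apply: word_spanMr Hy => w.
  by rewrite !(key_perm (permEl (perm_catC _ u))); apply: lexlt_key_cat.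
Qed.

End Words.

(** * Orders and denominators inside the ambient ring [Q] *)

Section OrdersInDivisionRing.
Variable Q : unitRingType.
Implicit Types (B R T I : set Q) (g : Q).

Definition subring B :=
  [/\ B 1, forall x y, B x -> B y -> B (x - y) & forall x y, B x -> B y -> B (x * y)].

Definition left_submodule B I :=
  [/\ I 0, forall x y, I x -> I y -> I (x - y) & forall r x, B r -> I x -> I (r * x)].

Definition left_acc B := ascending_chain_condition (fun I => left_submodule B I /\ I `<=` B).

(** [T] is the union of the [g^-n R]; as [g] normalises [R], denominators may be written on either
    side. *)
Definition power_localization R g T :=
  [/\ g \is a GRing.unit /\ R g,
      forall x, R x -> R (g * x * g^-1), forall x, R x -> R (g^-1 * x * g)
    & forall x, T x <-> exists n, R (g ^+ n * x)].

Definition maximal_in_fractions T :=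
  forall B a b, subring B -> T `<=` B -> a != 0 -> b != 0 ->
    (forall x, B x -> T (a * x * b)) -> B `<=` T.

(** Complete integral closedness of [R] in [T], restricted to denominators that are powers of
    [g]. *)
Definition power_denominators_trivial R g T :=
  forall q, T q -> (exists n, forall m, R (g ^+ n * q ^+ m)) -> R q.

Lemma subring0 B : subring B -> B 0.
Proof. by move=> [B1 BB _]; rewrite -(subrr 1); apply: BB. Qed.

Lemma subringX B x n : subring B -> B x -> B (x ^+ n).
Proof.
move=> [B1 _ BM] Bx; elim: n => [|n IH]; first by rewrite expr0.
by rewrite exprS; apply: BM.
Qed.

Lemma normal_power R g T n x : power_localization R g T -> R x ->
  R (g ^+ n * x * g ^- n) /\ R (g ^- n * x * g ^+ n).
Proof.
move=> [[Ug _] cg cg' _] Rx; elim: n => [|n [IH1 IH2]].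
  by rewrite expr0 invr1 !mul1r !mulr1.
have -> : g ^+ n.+1 * x * g ^- n.+1 = g * (g ^+ n * x * g ^- n) * g^-1.
  by rewrite exprS invrM ?unitrX // !mulrA.
have -> : g ^- n.+1 * x * g ^+ n.+1 = g^-1 * (g ^- n * x * g ^+ n) * g.
  by rewrite exprSr invrM ?unitrX // !mulrA.
by split; [apply: cg|apply: cg'].
Qed.

(* The set [Y] of the [z] with [B z <= T] is a right [T]-module with
   [B Y <= Y]. As [g] lies in [B], the chain
   [g^-n Y] is increasing, so it stabilises and [g^-1 Y <= Y]: the left order of
   [Y] contains [T], hence equals it, and [B <= T]. By noetherianity of [R],
   [B b <= R] then yields a common denominator [g ^+ M] for all of [B]. *)
Lemma order_of_left_denominator R T g B b :
  (forall q : Q, q != 0 -> q \is a GRing.unit) ->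
  subring R -> subring T -> power_localization R g T ->
  left_acc R -> @ascending_chain_condition Q^c (fun I =>
     [/\ I 0, forall x y, I x -> I y -> I (x - y) & forall r x, T r -> I x -> I (x * r)] /\ I `<=` T) ->
  maximal_in_fractions T -> power_denominators_trivial R g T ->
  subring B -> R `<=` B -> b != 0 -> (forall x, B x -> R (x * b)) -> B `<=` R.
Proof.
move=> fldQ sR sT loc accR accT maxT triv sB RB b0 Bb.
have [[Ug Rg] _ _ TE] := loc.
have [[[B1 BB BM] [R1 RD RM]] [T1 TD TM]] := (sB, sR, sT).
have RT x : R x -> T x by move=> Rx; apply/TE; exists 0%N; rewrite expr0 mul1r.
have TgV : T g^-1 by apply/TE; exists 1%N; rewrite expr1 mulrV.
have Bg n : B (g ^+ n) by apply: subringX => //; apply: RB.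
have Tg n : T (g ^- n) by rewrite -exprVn; apply: subringX.
pose Y : set Q := [set z | forall x, B x -> T (x * z)].
have YT z : Y z -> T z by move=> /(_ 1 B1); rewrite mul1r.
have Yb : Y b by move=> x Bx; apply/RT/Bb.
have BY x z : B x -> Y z -> Y (x * z).
  by move=> Bx Yz y By; rewrite mulrA; apply/Yz/BM.
pose C n : set Q := [set z | Y (g ^+ n * z)].
have [N stab] : exists N, forall n, (N <= n)%N -> C n = C N.
  apply: accT => n; last first.
    by move=> z Cz; rewrite /C /= exprS -mulrA; apply: BY Cz; apply: RB.
  split; last first.
    move=> z /YT Tz; rewrite -[z](mulKr (unitrX n Ug)); exact: TM.
  split.
  - by move=> x _; rewrite !mulr0; apply: subring0.
  - by move=> x y Cx Cy z Bz; rewrite !mulrBr; apply: TD; [apply: Cx|apply: Cy].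
  - by move=> r x Tr Cx z Bz; rewrite !mulrA; apply: TM => //; rewrite -mulrA; apply: Cx.
have YgV z : Y z -> Y (g^-1 * z).
  move=> Yz; have : C N.+1 (g ^- N.+1 * z) by rewrite /C /= mulVKr ?unitrX.
  rewrite (stab N.+1) // /C /= exprS invrM ?unitrX // -mulrA.
  by rewrite mulVKr ?unitrX.
pose O : set Q := [set q | forall y, Y y -> Y (q * y)].
have sO : subring O.
  split=> [y Yy|x y Ox Oy z Yz|x y Ox Oy z Yz]; first by rewrite mul1r.
    move=> w Bw; rewrite mulrBl mulrBr.
    by apply: TD; [apply: Ox|apply: Oy].
  by rewrite -mulrA; apply/Ox/Oy.
have BO x : B x -> O x by move=> Bx y; apply: BY.
(* Since [b] lies in [Y], the order [O] satisfies [O b <= T], so [1] and [b] serve as the two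
   denominators. *)
have OT : O `<=` T.
  apply: (maxT O 1 b) => //; last 2 first.
  - exact: oner_neq0.
  - by move=> x Ox; rewrite mul1r; apply/YT/Ox.
  move=> t /TE[n Rt]; rewrite -[t](mulKr (unitrX n Ug)) => y Yy.
  have OgV : O (g ^- n) by rewrite -exprVn; apply: (subringX n sO) => z; apply: YgV.
  by rewrite -mulrA; apply: OgV; apply: BO Yy; apply: RB.
have Ub := fldQ b b0.
(* [D n] collects the [x] of [R] such that [g^n] clears the denominator of [x b^-1]; once this
   increasing chain of left ideals is constant, [g^M] works for every element of [B]. *)
pose D n : set Q := [set x | R x /\ R (g ^+ n * x * b^-1)].
have [M stabD] : exists M, forall n, (M <= n)%N -> D n = D M.
  apply: accR => n; last first.
    by move=> x [Rx Dx]; split=> //; rewrite exprS -!mulrA; apply: RM; rewrite ?mulrA.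
  split; last by move=> x [].
  split.
  - by split; rewrite ?mulr0 ?mul0r; apply: subring0.
  - move=> x y [Rx Dx] [Ry Dy]; split; first exact: RD.
    by rewrite mulrBr mulrBl; apply: RD.
  - move=> r x Rr [Rx Dx]; split; first exact: RM.
    have [Rr' _] := normal_power n loc Rr.
    have -> : g ^+ n * (r * x) * b^-1 = (g ^+ n * r * g ^- n) * (g ^+ n * x * b^-1).
      by rewrite -!mulrA mulKr ?unitrX.
    exact: RM.
move=> q Bq; apply: triv; first exact/OT/BO.
exists M => m; have Bqm : B (q ^+ m) by apply: subringX.
have [n Rn] : exists n, R (g ^+ n * q ^+ m) by apply/TE/OT/BO.
have : D (maxn M n) (q ^+ m * b).
  split; first exact: Bb.
  rewrite mulrA mulrK // -(subnK (leq_maxr M n)) exprD -mulrA.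
  by apply: RM => //; apply: subringX.
by rewrite stabD ?leq_maxl // => -[_]; rewrite mulrA mulrK.
Qed.

End OrdersInDivisionRing.

(** * Passage to the converse ring, which exchanges the two sides *)

Lemma converse_expr (Q : unitRingType) (x : Q) n : (x : Q^c) ^+ n = x ^+ n.
Proof. exact: GRing.revrX. Qed.

Definition right_acc (Q : unitRingType) (B : set Q) := @left_acc Q^c B.

Lemma converse_subring (Q : unitRingType) (B : set Q) : subring B -> @subring Q^c B.
Proof. by case=> B1 BB BM; split=> // x y Bx By; apply: BM. Qed.

(** Conjugation by [g^n] turns a left denominator into a right one. *)
Lemma converse_power_localization (Q : unitRingType) (R T : set Q) g :
  power_localization R g T -> @power_localization Q^c R g T.
Proof.
move=> loc; have [[Ug Rg] cg cg' TE] := loc; split=> //.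
- by move=> x /cg'; rewrite -mulrA.
- by move=> x /cg; rewrite -mulrA.
move=> x; split=> [/TE[n Rn]|[n]]; last first.
  rewrite converse_expr => Rn; apply/TE; exists n.
  have [+ _] := normal_power n loc Rn.
  by rewrite mulrA mulrK ?unitrX.
exists n; rewrite converse_expr.
have [_ +] := normal_power n loc Rn.
by rewrite mulKr ?unitrX.
Qed.

Lemma converse_maximal (Q : unitRingType) (T : set Q) :
  maximal_in_fractions T -> @maximal_in_fractions Q^c T.
Proof.
move=> maxT B a b [B1 BB BM] TB a0 b0 BT.
apply: (maxT B b a) => // [|x Bx]; last by rewrite -mulrA; apply: BT.
by split=> // x y Bx By; apply: BM.
Qed.

Lemma converse_denominators (Q : unitRingType) (R T : set Q) g :
  power_localization R g T ->
  power_denominators_trivial R g T -> @power_denominators_trivial Q^c R g T.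
Proof.
move=> loc triv q Tq [n Hn]; apply: triv => //; exists n => m.
have := Hn m; rewrite !converse_expr => /(normal_power n loc)[+ _].
by rewrite mulrA mulrK ?unitrX //; case: loc => -[].
Qed.

(* The left order [S] of the right ideal [K] of the [v] in [R] with
   [a B v <= R] contains [R] and [a B], and
   satisfies [S b <= R]; this reduces the two-sided denominator to the two
   one-sided ones. *)
Lemma maximal_order_in_fractions (Q : unitRingType) (R T : set Q) g B a b :
  (forall q : Q, q != 0 -> q \is a GRing.unit) ->
  subring R -> subring T -> power_localization R g T ->
  left_acc R -> right_acc R -> left_acc T -> right_acc T ->
  maximal_in_fractions T -> power_denominators_trivial R g T ->
  subring B -> R `<=` B -> R a -> R b -> a != 0 -> b != 0 ->
  (forall x, B x -> R (a * x * b)) -> B `<=` R.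
Proof.
move=> fldQ sR sT loc laR raR laT raT maxT triv sB RB Ra Rb a0 b0 BR.
have [[B1 BB BM] [R1 RD RM]] := (sB, sR).
have aB x : B x -> R (a * x).
  pose K : set Q := [set v | R v /\ forall x, B x -> R (a * x * v)].
  pose S : set Q := [set s | forall v, K v -> K (s * v)].
  have sS : subring S.
    split=> [v|y z Sy Sz v Kv|y z Sy Sz v Kv]; first by rewrite mul1r.
      have [[Ry Ky] [Rz Kz]] := (Sy v Kv, Sz v Kv); rewrite mulrBl.
      by split=> [|w Bw]; rewrite ?mulrBr; apply: RD => //; [apply: Ky|apply: Kz].
    by rewrite -mulrA; apply/Sy/Sz.
  have SR : S `<=` R.
    apply: (order_of_left_denominator fldQ sR sT loc laR raT maxT triv sS _ b0).
      move=> r Rr v [Rv Kv]; split=> [|y By]; first exact: RM.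
      by rewrite mulrA -[a * y * r]mulrA; apply/Kv/BM => //; apply: RB.
    by move=> s /(_ b) Ks; case: Ks => //; split.
  move=> Bx; apply: SR => v [Rv Kv]; split; first exact: Kv.
  move=> y By; rewrite mulrA -[a * y * _]mulrA; apply: Kv.
  by do 2 ?apply: (BM) => //; apply: RB.
(* With [a B <= R] the factor [b] is gone, and in [Q^c] the factor [a] stands on the right, as the
   one-sided lemma requires. *)
apply: (@order_of_left_denominator Q^c R T g B a fldQ) => //.
- exact: converse_subring.
- exact: converse_subring.
- exact: converse_power_localization.
- exact: converse_maximal.
- exact: converse_denominators.
- exact: converse_subring.
Qed.

Lemma ideal_generated_two_sided (R : nzRingType) (X : set R) :
  two_sided_ideal (ideal_generated X).
Proof.
have I0 : ideal_generated X 0 by move=> I [[[/zmod_closedB[]]]].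
have IB x y : ideal_generated X x -> ideal_generated X y -> ideal_generated X (x - y).
  move=> Ix Iy I HI; have [[[/zmod_closedB[_ IB] _] _] _] := HI.
  by apply: IB; [apply: Ix|apply: Iy].
have zI : GRing.zmod_closed [in ideal_generated X].
  by split=> [|x y]; rewrite !in_setE //; apply: IB.
by split; split=> // r x Ix I HI; have [[[_ Il] [_ Ir]] _] := HI; [apply: Il|apply: Ir]; apply: Ix.
Qed.

(** * Normality of [gamma] and the completely prime ideals over [gamma A] *)

Section PrimesOverGamma.
Variables (k : fieldType) (A : algType k) (gr : nat -> set A).
Variables (d : Order.disp_t) (Pi : finPOrderType d) (e : Pi -> A).
Hypothesis hASL : quantum_graded_ASL e gr.
Variable gamma : Pi.
Hypothesis hgamma : forall x : Pi, minimal x <-> x = gamma.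
Hypothesis hdom : is_domain A.
Implicit Types (w u v : seq Pi) (W : seq Pi -> Prop) (p q tau : Pi) (x y : A).

Notation mon := (monomial e).
Notation g := (e gamma).

Lemma ASL_word_span x : word_span e (fun=> True) x.
Proof. by case: hASL => _ [_ [_ gen _ _ _]]; apply: generated_word_span. Qed.

Lemma ASL_standard_span w :
  word_span e (fun v => standard_word v /\ dominated w v) (mon w).
Proof. by case: hASL => _ [_ [_ _ _ inc qc]]; apply: standard_span. Qed.

Lemma ASL_noetherian : noetherian A.
Proof.
by case: hASL => _ [_ [_ gen _ inc qc]]; apply: (noetherian_of_straightening ASL_word_span).
Qed.

Lemma sum_support (c : seq Pi -> k) ws1 ws2 : uniq ws1 -> uniq ws2 ->
  (forall w, c w != 0 -> w \in ws1) -> (forall w, c w != 0 -> w \in ws2) ->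
  \sum_(w <- ws1) c w *: mon w = \sum_(w <- ws2) c w *: mon w.
Proof.
move=> u1 u2 s1 s2.
have nz (ws : seq (seq Pi)) : \sum_(w <- ws) c w *: mon w =
    \sum_(w <- [seq w <- ws | c w != 0]) c w *: mon w.
  rewrite big_filter (bigID (fun w => c w != 0)) /= [X in _ + X]big1 ?addr0 //.
  by move=> w /negPn/eqP->; rewrite scale0r.
rewrite nz [RHS]nz; apply: perm_big; apply: uniq_perm; rewrite ?filter_uniq // => w.
by rewrite !mem_filter; case: eqP => //= /eqP cw; rewrite s1 ?s2.
Qed.

Lemma word_span_sum W x : word_span e W x ->
  exists (c : seq Pi -> k) (ws : seq (seq Pi)), [/\ uniq ws, forall w, c w != 0 -> w \in ws,
    forall w, c w != 0 -> W w & x = \sum_(w <- ws) c w *: mon w].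
Proof.
elim=> [|c0 w0 y Ww0 _ [c [ws [uws sws Wc ->]]]].
  by exists (fun=> 0), [::]; split=> // [w /eqP//|w /eqP//|]; rewrite big_nil.
pose delta w := if w == w0 then c0 else 0.
have dw w : delta w != 0 -> w = w0 by rewrite /delta; case: (w =P w0) => // _; rewrite eqxx.
have cd w : c w + delta w != 0 -> c w != 0 \/ w = w0.
  by have [->|] := eqVneq (c w) 0; [rewrite add0r => /dw|]; auto.
exists (fun w => c w + delta w), (undup (w0 :: ws)).
split=> [|w /cd H|w /cd [/Wc//|->//]|]; first exact: undup_uniq.
  by rewrite mem_undup inE; case: H => [/sws->|->]; rewrite ?eqxx ?orbT.
have uV := undup_uniq (w0 :: ws); set V := undup _ in uV *.
under [RHS]eq_bigr do rewrite scalerDl.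
rewrite big_split /= [RHS]addrC; congr (_ + _); last first.
  apply: sum_support => // w /sws.
  by rewrite mem_undup inE orbC => ->.
transitivity (\sum_(w <- [:: w0]) delta w *: mon w).
  by rewrite big_seq1 /delta eqxx.
apply: sum_support => // w /dw->; first by rewrite inE.
by rewrite mem_undup mem_head.
Qed.

(** Independence makes coordinates unique, so one [c] serves every [W] at once; membership in
    several [I_tau] is later read off the same words. *)
Lemma standard_coordinates x :
  exists (c : seq Pi -> k) (ws : seq (seq Pi)), x = \sum_(w <- ws) c w *: mon w /\
    forall W, (forall w, W w -> standard_word w) -> word_span e W x ->
      forall w, c w != 0 -> W w.
Proof.
have ind : standard_monomials_independent e by case: hASL => _ [_ []].
have /word_span_sum[c [ws [uws sws Sc xE]]] : word_span e (fun w => standard_word w) x.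
  apply: word_span_trans (ASL_word_span x) => w _.
  by apply: word_spanS (ASL_standard_span w) => v [].
exists c, ws; split=> // W Wst /word_span_sum[c' [ws' [uws' sws' Wc xE']]] w cw.
apply: (Wc); suff <- : c w = c' w by [].
have nz v : v \in undup (ws ++ ws') -> c v - c' v = 0.
  pose S := [seq v <- undup (ws ++ ws') | standard_word v].
  have uS : uniq S by rewrite filter_uniq ?undup_uniq.
  have cS u : c u != 0 -> u \in S.
    by move=> cu; rewrite mem_filter Sc //= mem_undup mem_cat sws.
  have c'S u : c' u != 0 -> u \in S.
    move=> cu; rewrite mem_filter mem_undup mem_cat sws' ?orbT ?andbT //.
    exact/Wst/Wc.
  have S0 : \sum_(w <- S) (c w - c' w) *: mon w = 0.
    under eq_bigr do rewrite scalerBl.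
    rewrite sumrB (@sum_support c S ws) // (@sum_support c' S ws') //.
    by rewrite -xE -xE' subrr.
  have nS := ind S (fun w => c w - c' w) uS (filter_all _ _) S0.
  move=> _; have [vS|] := boolP (v \in S); first exact: nS.
  move=> vS; have /eqP-> : c v == 0 by apply: contraNT vS => /cS.
  by have /eqP-> : c' v == 0 by [apply: contraNT vS => /c'S]; rewrite subrr.
by apply/eqP; rewrite -subr_eq0 nz // mem_undup mem_cat sws.
Qed.

(** In a finite poset the only minimal element is the least one: descend along [rank]. *)
Lemma gamma_le p : (gamma <= p)%O.
Proof.
have [n] := ubnP (rank p); elim: n p => // n IH p ltn.
have [/hgamma->//|] := pselect (minimal p).
move=> /existsNP[q /negP/negPn ltqp].
by apply: le_trans (ltW ltqp); apply: IH; have := rank_lt ltqp; lia.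
Qed.

(** Nothing lies strictly below [gamma], so the straightening relation has no terms left. *)
Lemma gamma_quasi_commute p : exists2 c : k, c != 0 & g * e p = c *: (e p * g).
Proof.
have [_ [_ [_ _ _ _ qc]]] := hASL; have [c c0 H] := qc gamma p; exists c => //.
case: H => n [a [x [Hx /eqP]]]; rewrite subr_eq => /eqP->.
rewrite big1 ?add0r // => i _; have [l [lt _ _]] := Hx i.
by rewrite (le_gtF (gamma_le l)) in lt.
Qed.

Lemma gamma_monomial w : exists2 c : k, c != 0 & g * mon w = c *: (mon w * g).
Proof.
elim: w => [|p w [c c0 IH]].
  by exists 1; rewrite ?oner_neq0 // scale1r monomial_nil mulr1 mul1r.
have [c' c'0 H] := gamma_quasi_commute p; exists (c' * c); first by rewrite mulf_neq0.
by rewrite monomial_cons mulrA H -scalerAl -2!mulrA IH -scalerAr scalerA mulrA.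
Qed.

Lemma gamma_normal_l x : exists y, g * x = y * g.
Proof.
elim: (ASL_word_span x) => [|c w z _ _ [y IH]]; first by exists 0; rewrite mul0r mulr0.
have [c' _ H] := gamma_monomial w; exists ((c * c') *: mon w + y).
by rewrite mulrDr IH mulrDl -scalerAr H scalerA -scalerAl.
Qed.

Lemma gamma_normal_r x : exists y, x * g = g * y.
Proof.
elim: (ASL_word_span x) => [|c w z _ _ [y IH]]; first by exists 0; rewrite mul0r mulr0.
have [c' c'0 H] := gamma_monomial w; exists ((c / c') *: mon w + y).
by rewrite mulrDl IH mulrDr -scalerAr H scalerA divfK // -scalerAl.
Qed.

Lemma gamma_multiple_span x :
  word_span e (fun w => standard_word w /\ ohead w = Some gamma) (g * x).
Proof.
rewrite -[g]mulr1 -(monomial_nil e) -monomial_cons.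
have Sx : word_span e (fun w => standard_word w) x.
  apply: word_span_trans (ASL_word_span x) => w _.
  by apply: word_spanS (ASL_standard_span w) => v [].
apply: word_spanMl Sx => w st /=; split=> //.
by rewrite /standard_word; case: w st => //= p w ->; rewrite gamma_le.
Qed.

Lemma gamma_neq0 : g != 0.
Proof.
have ind : standard_monomials_independent e by case: hASL => _ [_ []].
apply/eqP => g0; have := ind [:: [:: gamma]] (fun=> 1) isT isT.
rewrite big_seq1 monomial_cons g0 mul0r scaler0 => /(_ erefl [:: gamma]).
by rewrite mem_head => /(_ isT)/eqP; rewrite oner_eq0.
Qed.

(** [1] is the monomial of the empty word, which is independent of the standard words starting with
    [gamma]. *)
Lemma one_notin_gamma x : g * x != 1.
Proof.
have ind : standard_monomials_independent e by case: hASL => _ [_ []].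
apply/eqP => gx; have := gamma_multiple_span x; rewrite gx.
case/word_span_sum => c [ws [uws sws Wc E]].
pose S := [seq w <- ws | c w != 0].
have nS : [::] \notin S by rewrite mem_filter; apply/negP => /andP[/Wc[]].
have c1 : [::] \in [:: [::] & S] by rewrite mem_head.
(* The coefficient [-1] of the empty word encodes the relation [g x - 1 = 0]. *)
have := ind ([::] :: S) (fun w => if w == [::] then -1 else c w).
have uS : uniq ([::] :: S) by rewrite /= nS filter_uniq.
have stS : all (@standard_word d Pi) ([::] :: S).
  by apply/allP => w; rewrite inE mem_filter => /orP[/eqP->//|/andP[/Wc[]]].
move=> /(_ uS stS) H.
have S0 : \sum_(w <- [::] :: S) (if w == [::] then -1 else c w) *: mon w = 0.
  rewrite big_cons eqxx monomial_nil scaleN1r {1}E.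
  rewrite (@sum_support c ws S) ?filter_uniq //; last first.
    by move=> w cw; rewrite mem_filter cw sws.
  rewrite addrC; apply/eqP; rewrite subr_eq0; apply/eqP; apply: eq_big_seq => w wS.
  by case: eqP wS nS => // -> ->.
by have /= /eqP := H S0 _ c1; rewrite ?eqxx oppr_eq0 oner_eq0.
Qed.

(** Words containing a letter not above [tau] span a two-sided ideal that contains the generators.
    Straightening such a word leaves a letter at most the given one, and the first letter is at most
    that, so it is not above [tau] either. *)
Lemma ideal_not_above_span tau x : ideal_not_above e tau x ->
  word_span e (fun w => standard_word w /\ exists2 p, ohead w = Some p & ~~ (tau <= p)%O) x.
Proof.
pose Wt w := exists2 p, p \in w & ~~ (tau <= p)%O.
have idW : two_sided_ideal (word_span e Wt).
  have zW : GRing.zmod_closed [in (word_span e Wt : set A)].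
    split=> [|y z]; rewrite !in_setE; first by constructor.
    exact: word_spanB.
  split; split=> //; [move=> r y Sy|move=> y r Sy].
    apply: (word_spanM _ (ASL_word_span r) Sy) => u v _ [p pv np].
    by exists p; rewrite // mem_cat pv orbT.
  apply: (word_spanM _ Sy (ASL_word_span r)) => u v [p pu np] _.
  by exists p; rewrite // mem_cat pu.
move=> Ix; have : word_span e Wt x.
  apply: Ix; split=> // _ [p np <-].
  rewrite -[e p]mulr1 -(monomial_nil e) -monomial_cons.
  by apply: word_spanw; exists p; rewrite ?mem_head.
apply: word_span_trans => w [p pw np].
apply: word_spanS (ASL_standard_span w) => v [sv /(_ p pw)[q qv leqp]]; split=> //.
case: v sv qv => // a v sv qv; exists a => //; apply: contra np => leta.
apply: le_trans leta (le_trans _ leqp); move: qv; rewrite inE => /orP[/eqP->//|qv].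
exact: (allP (order_path_min le_trans sv)).
Qed.

(** Conjugation by [gamma] rescales the generators of [I_tau], so the [y] arising from some [x] of
    [I_tau] form a two-sided ideal containing [I_tau]. That [A] is a domain makes [x] unique. *)
Lemma gamma_twist tau x y : ideal_not_above e tau y -> g * x = y * g ->
  ideal_not_above e tau x.
Proof.
set P := ideal_not_above e tau.
have [[zP Pl] [_ Pr]] : two_sided_ideal P by apply: ideal_generated_two_sided.
have [P0 PB] := zmod_closedB zP.
pose I : set A := [set y | exists2 x, P x & g * x = y * g].
have zI : GRing.zmod_closed [in I].
  split=> [|u v]; rewrite !in_setE; first by exists 0; rewrite ?mulr0 ?mul0r.
  by move=> [u' Pu Eu] [v' Pv Ev]; exists (u' - v'); [exact: PB|rewrite mulrBr mulrBl Eu Ev].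
have : two_sided_ideal I.
  split; split=> //; [move=> r u|move=> u r] => -[u' Pu Eu]; have [r' Er] := gamma_normal_r r.
    by exists (r' * u'); [exact: Pl|rewrite mulrA -Er -mulrA Eu mulrA].
  by exists (u' * r'); [exact: Pr|rewrite mulrA Eu -!mulrA Er].
move=> idI Py gx; have [x' Px' gx'] : I y.
  apply: Py; split=> // _ [p np <-]; have [c c0 H] := gamma_quasi_commute p.
  exists (c^-1 *: e p); last by rewrite -scalerAr H scalerA mulVf // scale1r.
  rewrite -[e p]mul1r scalerAl; apply: Pl => J [_]; apply; exists p => //.
have /hdom[/eqP|/eqP] : g * (x - x') = 0 by rewrite mulrBr gx gx' subrr.
  by rewrite (negPf gamma_neq0).
by rewrite subr_eq0 => /eqP->.
Qed.

Lemma upper_neighbour_le p : p != gamma ->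
  exists2 tau, upper_neighbour gamma tau & (tau <= p)%O.
Proof.
have [n] := ubnP (rank p); elim: n p => // n IH p ltn np.
have lt : (gamma < p)%O by rewrite lt_def np gamma_le.
have [ex|nex] := pselect (exists nu : Pi, (gamma < nu)%O && (nu < p)%O); last first.
  by exists p.
have [q /andP[gq qp]] := ex; have rq := rank_lt qp.
have nq : q != gamma by rewrite gt_eqF.
have [|tau ut le] := IH q _ nq; first lia.
by exists tau => //; apply: le_trans le (ltW qp).
Qed.

(** A first letter other than [gamma] is above some upper neighbour [tau], which membership in
    [I_tau] forbids; so each standard word of [x] starts with [gamma]. *)
Lemma mem_all_ideals tau0 x : upper_neighbour gamma tau0 ->
  (forall tau, upper_neighbour gamma tau -> ideal_not_above e tau x) ->
  exists y, x = g * y.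
Proof.
move=> u0 Hx; have [c [ws [xE H]]] := standard_coordinates x.
rewrite xE; elim/big_rec: _ => [|w y _ [z ->]]; first by exists 0; rewrite mulr0.
have [->|cw] := eqVneq (c w) 0; first by exists z; rewrite scale0r add0r.
have hd tau : upper_neighbour gamma tau -> exists2 p, ohead w = Some p & ~~ (tau <= p)%O.
  move=> ut; have := H _ _ (ideal_not_above_span (Hx tau ut)) w cw.
  by case=> // v [].
(* The given neighbour [tau0] serves to exclude the empty word. *)
have [p wp _] := hd tau0 u0; case: w wp cw hd => // a w [->] _ hd.
have -> : p = gamma.
  apply/eqP; apply: contraT => /upper_neighbour_le[tau ut le].
  by have [q [<-]] := hd tau ut; rewrite le.
by exists (c (gamma :: w) *: mon w + z); rewrite monomial_cons mulrDr scalerAr.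
Qed.

Hypothesis hprime : forall tau : Pi, upper_neighbour gamma tau ->
  completely_prime (ideal_not_above e tau).

(* If [gamma] has no upper neighbour then [Pi = [set gamma]] and
   [gamma A] itself is the completely prime ideal. *)
Lemma completely_prime_avoiding x : (forall y, x != g * y) ->
  exists P : set A, [/\ completely_prime P, forall y, P (g * y), ~ P x
    & forall y z, P z -> g * y = z * g -> P y].
Proof.
move=> gx.
have [[tau0 u0]|nu] := pselect (exists tau, upper_neighbour gamma tau).
  have [tau /not_implyP[ut nP]] : exists tau,
      ~ (upper_neighbour gamma tau -> ideal_not_above e tau x).
    apply/existsNP => /(mem_all_ideals u0)[y xE].
    by have := gx y; rewrite xE eqxx.
  exists (ideal_not_above e tau); split=> //; first exact: hprime.
    have [[_ _] [_ Pr]] := ideal_generated_two_sided (e @` [set p | ~~ (tau <= p)%O]).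
    move=> y; apply: Pr => I [_]; apply; exists gamma => //=.
    by rewrite lt_geF //; case: ut.
  by move=> y z; apply: gamma_twist.
have allg p : p = gamma.
  by apply/eqP; apply: contraT => /upper_neighbour_le[tau ut _]; case: nu; exists tau.
pose P : set A := [set z | exists y, z = g * y].
have zP : GRing.zmod_closed [in P].
  split=> [|u v]; rewrite !in_setE; first by exists 0; rewrite mulr0.
  by move=> [u' ->] [v' ->]; exists (u' - v'); rewrite mulrBr.
have Pr (u r : A) : P u -> P (u * r) by move=> [y ->]; exists (y * r); rewrite mulrA.
have Pl (r u : A) : P u -> P (r * u).
  move=> [y ->]; have [r' E] := gamma_normal_r r.
  by exists (r' * y); rewrite mulrA E mulrA.
have PB (u v : A) : P u -> P v -> P (u - v) by case: (zmod_closedB zP) => _; apply.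
have PD (u v : A) : P u -> P v -> P (u + v).
  by move=> [u' ->] [v' ->]; exists (u' + v'); rewrite mulrDr.
have P1 : ~ P 1 by move=> [y]; apply/eqP; rewrite eq_sym one_notin_gamma.
exists P; split.
- split=> // u v Puv.
  (* All letters being [gamma], every element is a scalar modulo [gamma A]; the quotient is thus
     [k]. *)
  have scal z : exists a : k, P (z - a%:A).
    elim: (ASL_word_span z) => [|c w z' _ _ [a Pa]].
      by exists 0; rewrite scale0r subrr; exists 0; rewrite mulr0.
    case: w => [|p w].
      by exists (c + a); rewrite monomial_nil scalerDl opprD addrACA subrr add0r.
    have P0 : P 0 by exists 0; rewrite mulr0.
    exists a; have -> : c *: mon (p :: w) + z' - a%:A =
        (z' - a%:A) - (0 - c *: mon (p :: w)).
      by rewrite sub0r opprK -addrA addrC.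
    apply: (PB) => //; apply: (PB) => //.
    by rewrite monomial_cons (allg p); exists (c *: mon w); rewrite scalerAr.
  have [[a Pa] [b Pb]] := (scal u, scal v).
  have Pab : P ((a * b)%:A).
    have -> : (a * b)%:A = u * v - ((u - a%:A) * v + a%:A * (v - b%:A)) :> A.
      rewrite mulrBl mulrBr addrA subrK -scalerAr mulr1 scalerA mulrC.
      by rewrite opprB addrCA subrr addr0.
    by apply: PB => //; apply: PD; [apply: Pr|apply: Pl].
  have [a0|a0] := eqVneq a 0; first by left; move: Pa; rewrite a0 scale0r subr0.
  have [b0|b0] := eqVneq b 0; first by right; move: Pb; rewrite b0 scale0r subr0.
  case: P1; have -> : 1 = (a * b)^-1%:A * (a * b)%:A :> A.
    by rewrite -scalerAl mul1r scalerA mulVf ?scale1r // mulf_neq0.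
  exact: Pl.
- by move=> y; exists y.
- by move=> [y xE]; have := gx y; rewrite xE eqxx.
- move=> y z [z' ->] E; have [r' E'] := gamma_normal_r z'.
  exists r'; rewrite -E'; apply/eqP; rewrite -subr_eq0.
  have /hdom[/eqP|->//] : g * (y - z' * g) = 0 by rewrite mulrBr E mulrA subrr.
  by rewrite (negPf gamma_neq0).
Qed.

Variables (Q : unitRingType) (iota : {rmorphism A -> Q}).
Hypothesis iota_inj : injective iota.
Hypothesis Ug : iota g \is a GRing.unit.

(* If [q = g^-n a] with [n > 0] and [a] outside [g A], choose a prime [P] over
   [g A] avoiding [a]: then [g^(nm) q^m] is a product of conjugates of [a] by
   powers of [g], so it avoids [P], against [g^N q^m] being in [A] for [m > N]. *)
Lemma trivial_power_denominators T : power_localization (range iota) (iota g) T ->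
  power_denominators_trivial (range iota) (iota g) T.
Proof.
move=> [_ _ _ TE] q /TE exn [N HN].
have exb : exists n, `[< range iota (iota g ^+ n * q) >].
  by have [n Hn] := exn; exists n; apply/asboolP.
(* The exponent [n.+1] of [g] is taken least, which keeps [a] out of [g A]. *)
case: (ex_minnP exb) => -[|n] /asboolP Rn minn; first by rewrite expr0 mul1r in Rn.
have [a _ aE] := Rn.
have [|P [[_ P1 Pp] gP nPa tw]] := @completely_prime_avoiding a.
  move=> y; apply/eqP => ay; have : (n.+1 <= n)%N; last by rewrite ltnn.
  apply: minn; apply/asboolP; exists y => //; apply: (mulrI Ug).
  by rewrite mulrA -exprS -aE ay rmorphM.
have twist j b : ~ P b -> exists2 b', ~ P b' & iota g ^+ j * iota b = iota b' * iota g ^+ j.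
  elim: j => [|j IH] nPb; first by exists b; rewrite // mulr1 mul1r.
  have [b' nPb' E] := IH nPb; have [b'' E'] := gamma_normal_l b'.
  exists b''; first by move=> Pb''; apply: nPb'; apply: tw Pb'' E'.
  by rewrite exprS -mulrA E !mulrA -!rmorphM E'.
have pow m : exists2 c, ~ P c & iota c = iota g ^+ (n.+1 * m) * q ^+ m.
  elim: m => [|m [c nPc cE]]; first by exists 1; rewrite // muln0 rmorph1 mulr1.
  have [b nPb bE] := twist (n.+1 * m)%N a nPa.
  exists (b * c); first by case/Pp.
  rewrite rmorphM cE mulrA -bE aE mulnS addnC exprD [q ^+ m.+1]exprS.
  by rewrite !mulrA.
(* For [m = N + 1] the exponent [(n + 1) m] is at least [N + 1]: besides the [g^N] that brings [q^m]
   into [A], a factor [g] remains. *)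
have [c nPc cE] := pow N.+1; have [r _ rE] := HN N.+1.
case: nPc; have -> : c = g * (g ^+ (n.+1 * N.+1 - N.+1) * r); last exact: gP.
apply: iota_inj; rewrite cE !rmorphM rmorphXn rE !mulrA -exprS -exprD.
by congr (_ ^+ _ * _); nia.
Qed.

End PrimesOverGamma.

(** * Embedding the localisation in [Q] and transporting chain conditions *)

(** Fractions [phi a / phi g^n] go to [iota a / iota g^n]; injectivity of [phi] makes this well
    defined and normality of [g] makes it multiplicative. *)
Lemma localization_extend (A : nzRingType) (L Q : unitRingType) (g : A)
    (phi : {rmorphism A -> L}) (iota : {rmorphism A -> Q}) :
  (forall x, exists y, x * g = g * y) -> injective phi ->
  phi g \is a GRing.unit -> (forall l : L, exists a n, l = phi a / phi g ^+ n) ->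
  iota g \is a GRing.unit ->
  exists psi : {rmorphism L -> Q}, forall a, psi (phi a) = iota a.
Proof.
move=> norm phi_inj Up surj Uq.
have normX n x : exists y, x * g ^+ n = g ^+ n * y.
  elim: n x => [|n IH] x; first by exists x; rewrite mulr1 mul1r.
  have [y E] := norm x; have [z E'] := IH y.
  by exists z; rewrite exprS mulrA E -mulrA E' mulrA.
pose rel l q := forall a n, l * phi g ^+ n = phi a -> q * iota g ^+ n = iota a.
have relI l q a n : l * phi g ^+ n = phi a -> q * iota g ^+ n = iota a -> rel l q.
  move=> la qa b m lb; apply: (mulIr (unitrX n Uq)).
  have ab : a * g ^+ m = b * g ^+ n.
    apply: phi_inj; rewrite !rmorphM !rmorphXn /= -la -lb -!mulrA -!exprD.
    by rewrite addnC.
  by rewrite -mulrA -exprD addnC exprD mulrA qa -!rmorphXn -!rmorphM ab.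
have ex l : exists q, rel l q.
  have [a [n lE]] := surj l; exists (iota a / iota g ^+ n).
  by apply: (relI _ _ a n); rewrite ?lE divrK ?unitrX.
have den l : exists an : A * nat, l * phi g ^+ an.2 = phi an.1.
  by have [a [n lE]] := surj l; exists (a, n); rewrite lE divrK ?unitrX.
have [f fP] := choice ex.
have fE l q a n : l * phi g ^+ n = phi a -> q * iota g ^+ n = iota a -> f l = q.
  by move=> la qa; apply: (mulIr (unitrX n Uq)); rewrite (fP _ _ _ la).
have fphi a : f (phi a) = iota a by apply: (fE _ _ a 0%N); rewrite mulr1.
have fB : GRing.zmod_morphism f.
  move=> l m; have [[a i] /= la] := den l; have [[b j] /= mb] := den m.
  apply: (fE _ _ (a * g ^+ j - b * g ^+ i) (i + j)%N).
    rewrite mulrBl rmorphB !rmorphM !rmorphXn /= -la -mb -!mulrA -!exprD.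
    by rewrite [(j + i)%N]addnC.
  rewrite mulrBl rmorphB !rmorphM !rmorphXn /= -(fP _ _ _ la) -(fP _ _ _ mb).
  by rewrite -!mulrA -!exprD [(j + i)%N]addnC.
have fM : GRing.monoid_morphism f.
  split=> [|l m]; first by rewrite -(rmorph1 phi) fphi rmorph1.
  have [[a i] /= la] := den l; have [[b j] /= mb] := den m.
  (* Normality moves the denominator of [l] past the numerator of [m]. *)
  have [c E] := normX i b.
  apply: (fE _ _ (a * c) (j + i)%N).
    rewrite exprD -mulrA [m * _]mulrA mb rmorphM -la -mulrA; congr (_ * _).
    by rewrite -rmorphXn -!rmorphM E.
  rewrite exprD -mulrA [f m * _]mulrA (fP _ _ _ mb) rmorphM -(fP _ _ _ la) -mulrA; congr (_ * _).
  by rewrite -rmorphXn -!rmorphM E.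
pose psi : {rmorphism L -> Q} := HB.pack f
  (GRing.isZmodMorphism.Build L Q f fB) (GRing.isMonoidMorphism.Build L Q f fM).
by exists psi.
Qed.

Section RangeOfMorphism.
Variables (S : nzRingType) (Q : unitRingType) (f : {rmorphism S -> Q}).

Lemma subring_range : subring (range f).
Proof.
split; first by exists 1; rewrite ?rmorph1.
  by move=> _ _ [x _ <-] [y _ <-]; exists (x - y); rewrite ?rmorphB.
by move=> _ _ [x _ <-] [y _ <-]; exists (x * y); rewrite ?rmorphM.
Qed.

Lemma preimage_zmod_closed (I : set Q) : I 0 ->
  (forall x y, I x -> I y -> I (x - y)) -> GRing.zmod_closed [in f @^-1` I].
Proof.
move=> I0 IB; split=> [|x y]; rewrite !in_setE /preimage /=; first by rewrite rmorph0.
by rewrite rmorphB; apply: IB.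
Qed.

(** A subset of the range is recovered from its preimage, so a chain stabilises as soon as its
    preimages do. *)
Lemma acc_range (P : set S -> Prop) (P' : set Q -> Prop) :
  (forall I, P' I -> I `<=` range f /\ P (f @^-1` I)) ->
  ascending_chain_condition P -> ascending_chain_condition P'.
Proof.
move=> PP' acc C PC incC.
have [||N stab] := acc (fun n => f @^-1` C n).
- by move=> n; case: (PP' _ (PC n)).
- by move=> n x; apply: incC.
exists N => n leNn; have := stab n leNn => /seteqP[s1 s2].
have [Rn _] := PP' _ (PC n); have [RN _] := PP' _ (PC N).
by apply/seteqP; split=> y Cy; [have [x _ xE] := Rn y Cy|have [x _ xE] := RN y Cy];
  rewrite -xE in Cy *; [apply: s1|apply: s2].
Qed.

Lemma noetherian_range : noetherian S -> left_acc (range f) /\ right_acc (range f).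
Proof.
move=> [accl accr]; split.
  apply: acc_range accl => I [[I0 IB IM] IR]; split=> //.
  split; first exact: preimage_zmod_closed.
  by move=> r x Ix; rewrite /preimage /= rmorphM; apply: IM => //; exists r.
apply: (@acc_range _ _ _ accr) => I [[I0 IB IM] IR]; split=> //.
split; first exact: preimage_zmod_closed.
by move=> x r Ix; rewrite /preimage /= rmorphM; apply: IM => //; exists r.
Qed.

End RangeOfMorphism.

(** * Transfer of maximality from $A[\gamma^{-1}]$ to $A$ inside [Q] *)

Theorem proposition2p2p2 (k : fieldType) (A : algType k)
    (gr : nat -> set A)
    (d : Order.disp_t) (Pi : finPOrderType d) (e : Pi -> A)
    (hASL : quantum_graded_ASL e gr)
    (gamma : Pi)
    (hgamma : forall x : Pi, minimal x <-> x = gamma)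
    (hdom : is_domain A)
    (hprime : forall tau : Pi, upper_neighbour gamma tau ->
       completely_prime (ideal_not_above e tau))
    (L : unitRingType) (phi : {rmorphism A -> L})
    (hL : is_localization_at_powers (e gamma) phi)
    (hmax : maximal_order L) :
  maximal_order A.
Proof.
set g := e gamma.
have nA := ASL_noetherian hASL.
have nl := gamma_normal_l hASL hgamma; have nr := gamma_normal_r hASL hgamma.
have g0 : g != 0 := gamma_neq0 hASL gamma.
split=> // Q iota [fldQ iota_inj fracr fracl] [B [sB [RB nBR] [a [b [a0 b0 aBb]]]]].
have [Up surj ker] := hL; have [nL _ maxL] := hmax.
have gX n x : x * g ^+ n = 0 -> x = 0.
  elim: n => [|n IH]; first by rewrite mulr1.
  by rewrite exprSr mulrA => /hdom[//|/eqP]; rewrite (negPf g0).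
(* The kernel of [phi] consists of elements killed by a power of [g], which is regular in a
   domain. *)
have phi_inj : injective phi.
  move=> x y /eqP; rewrite -subr_eq0 -rmorphB => /eqP/ker[n /gX/eqP].
  by rewrite subr_eq0 => /eqP.
have iota0 x : x != 0 -> iota x != 0.
  by apply: contraNneq; rewrite -(rmorph0 iota) => /iota_inj->.
have Ug : iota g \is a GRing.unit by apply/fldQ/iota0.
have [psi psiE] := localization_extend nr phi_inj Up surj Ug.
have psiX n : psi (phi g ^+ n) = iota g ^+ n by rewrite rmorphXn psiE.
have nlX n x : exists y, g ^+ n * x = y * g ^+ n.
  elim: n => [|n [y E]]; first by exists x; rewrite mulr1 mul1r.
  by have [z E'] := nl y; exists z; rewrite exprS -mulrA E mulrA E' mulrA.
have loc : power_localization (range iota) (iota g) (range psi).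
  split.
  - by split=> //; exists g.
  - move=> _ [x _ <-]; have [y E] := nl x; exists y => //.
    by rewrite -rmorphM E rmorphM mulrK.
  - move=> _ [x _ <-]; have [y E] := nr x; exists y => //.
    by rewrite -mulrA -rmorphM E rmorphM mulKr.
  move=> x; split=> [[l _ <-]|[n [c _ cE]]].
    have [c [n ->]] := surj l; exists n; have [y E] := nlX n c; exists y => //.
    rewrite rmorphM rmorphV ?unitrX // psiE psiX mulrA -rmorphXn -rmorphM E.
    by rewrite rmorphM rmorphXn mulrK ?unitrX.
  exists ((phi g ^+ n)^-1 * phi c) => //.
  by rewrite rmorphM rmorphV ?unitrX // psiE psiX cE mulKr ?unitrX.
have psi_inj : injective psi.
  move=> l m /eqP; rewrite -subr_eq0 -rmorphB => /eqP lm0; apply/eqP; rewrite -subr_eq0.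
  move: lm0; have [c [n ->]] := surj (l - m).
  rewrite rmorphM rmorphV ?unitrX // psiE psiX => /(congr1 (fun z => z * iota g ^+ n)).
  rewrite mul0r divrK ?unitrX // -(rmorph0 iota) => /iota_inj->.
  by rewrite rmorph0 mul0r.
have phi0 x : x != 0 -> phi x != 0.
  by apply: contraNneq; rewrite -(rmorph0 phi) => /phi_inj->.
(* Fractions over [A] are fractions over [L] too, so maximality of [L] may be applied in the same
   [Q]. *)
have fracT : is_division_ring_of_fractions psi.
  split=> // q.
    by have [x [y [y0 ->]]] := fracr q; exists (phi x), (phi y); rewrite !psiE phi0.
  by have [x [y [y0 ->]]] := fracl q; exists (phi x), (phi y); rewrite !psiE phi0.
have maxT : maximal_in_fractions (range psi).
  move=> O u v [O1 OB OM] TO u0 v0 uOv; apply: contrapT => nOT.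
  apply: (maxL Q psi fracT); exists O; split.
  - by split=> [|x y|x y]; rewrite !in_setE //; [apply: OB|apply: OM].
  - by split.
  - by exists u, v.
have sB' : subring B.
  case: sB => B1 BB BM; split=> [|x y Bx By|x y Bx By]; first by rewrite in_setE in B1.
    by have := BB x y; rewrite !in_setE; apply.
  by have := BM x y; rewrite !in_setE; apply.
(* With [a = c'^-1 c] and [b = s s'^-1], the set [c B s = c' (a B b) s'] lies in the image of [A],
   so both denominators may be taken from [A]. *)
have [c [c' [c'0 aE]]] := fracl a; have [s [s' [s'0 bE]]] := fracr b.
have Uc' := fldQ _ (iota0 _ c'0); have Us' := fldQ _ (iota0 _ s'0).
have [laR raR] := noetherian_range iota nA; have [laT raT] := noetherian_range psi nL.
apply: nBR; apply: (@maximal_order_in_fractions Q _ (range psi) (iota g) B (iota c) (iota s)) => //.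
- exact: subring_range.
- exact: subring_range.
- exact: (trivial_power_denominators hASL hgamma hdom hprime).
- by apply: contra_neq a0 => c0; rewrite aE c0 mulr0.
- by apply: contra_neq b0 => s0; rewrite bE s0 mul0r.
move=> x /aBb[r _ rE]; exists (c' * r * s') => //.
by rewrite !rmorphM rE aE bE !mulrA mulrV // mul1r -!mulrA mulVr // mulr1.
Qed.
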